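(* Under the setting and Assumptions A1–A4 described in the context, let $\{\mathcal{X}^t\}_{t\in\mathbb{N}}$ be the sequence generated by the TNNR iteration. Then: (i) $\{\mathcal{X}^t\}$ is bounded and has at least one accumulation point, i.e. there exist $\mathcal{X}^\star$ and a subsequence $\{\mathcal{X}^{t_l}\}$ with $\lim_{l\to\infty}\mathcal{X}^{t_l}=\mathcal{X}^\star$; (ii) the sequence $\{F(\mathcal{X}^t)\}$ is convergent; (iii) every accumulation point $\mathcal{X}^\star=\lim_{l\to\infty}\mathcal{X}^{t_l}$ of $\{\mathcal{X}^t\}$ is a stationary point of $F$, i.e. $0\in\partial F(\mathcal{X}^\star)$ (limiting subdifferential), and moreover $F(\mathcal{X}^{t_l+1})\to F(\mathcal{X}^\star)$ as $l\to\infty$.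
   Context: Tensors: fix positive integers $n_1,n_2,n_3$, let $r=\min\{n_1,n_2\}$. For $\mathcal{X}\in\mathbb{R}^{n_1\times n_2\times n_3}$, $\|\mathcal{X}\|$ is the Frobenius norm (square root of the sum of squared entries) and $\langle\cdot,\cdot\rangle$ the entrywise inner product. $\bar{\mathcal{X}}\in\mathbb{C}^{n_1\times n_2\times n_3}$ is the (unnormalized) discrete Fourier transform of $\mathcal{X}$ along the third mode, $\bar{\mathcal{X}}(i,j,:)=F_{n_3}\mathcal{X}(i,j,:)$ with $F_{n_3}$ the $n_3\times n_3$ DFT matrix $(\omega^{(p-1)(q-1)})_{p,q}$, $\omega=e^{-2\pi\sqrt{-1}/n_3}$; $\bar X^{(k)}$ is its $k$-th frontal slice, and $\sigma_i^k(\mathcal{X})$ denotes the $i$-th largest singular value of $\bar X^{(k)}$, $i\in[r]$, $k\in[n_3]$. Assumption A1: $\rho:[0,\infty)\to[0,\infty)$ is differentiable and concave, $\rho'$ is Lipschitz continuous with constant $L_g$, and $\rho'(t)>0$ for all $t\ge 0$. Assumption A2: $f:\mathbb{R}^{n_1\times n_2\times n_3}\to[0,\infty)$ is continuously differentiable and $\nabla f$ is $L_f$-Lipschitz ($L_f>0$). Objective: for $\lambda>0$, $F(\mathcal{X})=\lambda\sum_{k=1}^{n_3}\rho\Big(\sum_{i=1}^r\rho\big(\rho(\sigma_i^k(\mathcal{X}))\big)\Big)+f(\mathcal{X})$. Assumption A3: $F$ is coercive ($F(\mathcal{X})\to+\infty$ as $\|\mathcal{X}\|\to\infty$) and bounded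 below. Weighted function: for weights $\alpha=(\alpha_k)_{k\in[n_3]}$, $\beta=(\beta_i^k)$, $\|\mathcal{X}\|_{\rho_\alpha^\beta}=\sum_{k=1}^{n_3}\sum_{i=1}^r\alpha_k\beta_i^k\rho(\sigma_i^k(\mathcal{X}))$. TNNR iteration: start from $\mathcal{X}^0$ and set $\mathcal{X}^{-1}=\mathcal{X}^0$; for every $t\ge 0$ the weights are $\alpha_k^t=\rho'\big(\sum_{i=1}^r\rho(\rho(\sigma_i^k(\mathcal{X}^t)))\big)$, $\beta_i^{k,t}=\rho'\big(\rho(\sigma_i^k(\mathcal{X}^t))\big)$, and $\mathcal{Y}^t=\mathcal{X}^t+\theta_1^t(\mathcal{X}^t-\mathcal{X}^{t-1})$, $\mathcal{Z}^t=\mathcal{X}^t+\theta_2^t(\mathcal{X}^t-\mathcal{X}^{t-1})$, $\mathcal{X}^{t+1}\in\arg\min_{\mathcal{X}}\ \lambda\|\mathcal{X}\|_{\rho_{\alpha^t}^{\beta^t}}+\langle\mathcal{X}-\mathcal{Y}^t,\nabla f(\mathcal{Z}^t)\rangle+\frac{\mu^t}{2}\|\mathcal{X}-\mathcal{Y}^t\|^2$ (a global minimizer). Assumption A4: for some fixed $\varepsilon\in(0,1)$ and all $t$: $\theta_1^t\in[0,(1-\varepsilon)/2)$, $\theta_2^t\in[0,1/2]$, $(\mu^t)$ is nonincreasing and $\mu^0\ge\mu^t\ge\max\{\theta_2^tL_f/\theta_1^t,\ (1-\theta_2^t)L_f/(1-\theta_1^t-\theta_1^{t+1}-\varepsilon)\}$.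 *)

(* Defs.v *)
(* MathComp + MathComp-Analysis (R : realType), complex numbers R[i]
   from mathcomp-real-closed. *)
From mathcomp Require Import all_boot all_order all_algebra.
From mathcomp Require Import all_classical all_reals all_analysis.
From mathcomp Require Import complex.
Import Order.TTheory GRing.Theory Num.Theory.
Import numFieldNormedType.Exports.
Local Open Scope classical_set_scope.
Local Open Scope ring_scope.

Set Implicit Arguments.
Unset Strict Implicit.
Unset Printing Implicit Defensive.

(* A third-order real tensor in R^{n1 x n2 x n3}, given by its n3 frontal
   slices: X k is the k-th frontal slice (an n1 x n2 real matrix), so the
   entry (i,j,k) of the paper is X k i j (0-based indices). *)
Definition tensor (R : realType) (n1 n2 n3 : nat) := 'I_n3 -> 'M[R]_(n1, n2).

Section Tensors.
Variables (R : realType) (n1 n2 n3 : nat).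
Local Notation T := (tensor R n1 n2 n3).

(* entrywise inner product and Frobenius norm *)
Definition tdot (X Y : T) : R :=
  \sum_(k < n3) \sum_(i < n1) \sum_(j < n2) X k i j * Y k i j.
Definition tnorm (X : T) : R := Num.sqrt (tdot X X).

(* tensor operations (pointwise) *)
Definition tadd (X Y : T) : T := fun k => X k + Y k.
Definition tsub (X Y : T) : T := fun k => X k - Y k.
Definition tscale (a : R) (X : T) : T := fun k => a *: X k.
Definition tzero : T := fun _ => 0.

(* omega = e^{-2 pi sqrt(-1)/n3} *)
Definition dft_omega : R[i] :=
  (cos (2 * pi / n3%:R) -i* sin (2 * pi / n3%:R))%C.

(* unnormalized DFT along the third mode; k-th frontal slice of Xbar,
   Xbar(i,j,k) = sum_q omega^{k q} X(i,j,q)   (0-based indices) *)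
Definition tdft (X : T) (k : 'I_n3) : 'M[R[i]]_(n1, n2) :=
  \matrix_(i < n1, j < n2)
     \sum_(q < n3) dft_omega ^+ (k * q) * ((X q i j)%:C)%C.
End Tensors.

(* ---------- singular values of a complex matrix ---------- *)

Lemma char_poly_split (C : closedFieldType) (n : nat) (M : 'M[C]_n) :
  exists s : seq C, char_poly M == \prod_(z <- s) ('X - z%:P).
Proof.
have [s Hs] := closed_field_poly_normal (char_poly M).
exists s; apply/eqP; rewrite {1}Hs.
by rewrite (monicP (char_poly_monic M)) scale1r.
Qed.

(* the eigenvalues of a square complex matrix, listed with algebraic
   multiplicity (roots of the characteristic polynomial) *)
Definition eigenvalues (C : closedFieldType) (n : nat) (M : 'M[C]_n) : seq C :=
  xchoose (char_poly_split M).

(* conjugate transpose *)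
Definition conjT (R : realType) (m n : nat) (A : 'M[R[i]]_(m, n)) :
  'M[R[i]]_(n, m) := (map_mx (fun z => (z^*)%C) A)^T.

(* singular values of A in nonincreasing order: square roots of the
   eigenvalues of A^* A (which are real and nonnegative), sorted in
   nonincreasing order; singval A i is the (i+1)-th largest singular value
   (meaningful for i < min(m,n)). *)
Definition singvals (R : realType) (m n : nat) (A : 'M[R[i]]_(m, n)) : seq R :=
  sort (fun x y : R => y <= x)
       [seq Num.sqrt (complex.Re z) | z <- eigenvalues (conjT A *m A)].
Definition singval (R : realType) (m n : nat) (A : 'M[R[i]]_(m, n)) (i : nat) : R :=
  nth 0 (singvals A) i.

(* sigma_i^k(X): i-th largest singular value of the k-th frontal slice of
   the Fourier transformed tensor *)
Definition tsigma (R : realType) (n1 n2 n3 : nat) (X : tensor R n1 n2 n3)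
  (k : 'I_n3) (i : nat) : R := singval (tdft X k) i.

(* ---------- the objective ---------- *)
Definition objF (R : realType) (n1 n2 n3 : nat) (lam : R) (rho : R -> R)
  (f : tensor R n1 n2 n3 -> R) (X : tensor R n1 n2 n3) : R :=
  lam * (\sum_(k < n3)
           rho (\sum_(i < minn n1 n2) rho (rho (tsigma X k i))))
  + f X.

(* weighted function ||X||_{rho_alpha^beta} *)
Definition wnorm (R : realType) (n1 n2 n3 : nat) (rho : R -> R)
  (alpha : 'I_n3 -> R) (beta : 'I_n3 -> nat -> R) (X : tensor R n1 n2 n3) : R :=
  \sum_(k < n3) \sum_(i < minn n1 n2) alpha k * beta k i * rho (tsigma X k i).

(* ---------- subdifferentials ---------- *)
(* Frechet (regular) subdifferential, written out:
   V in dhat F(X) iff liminf_{Y -> X, Y <> X}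
      (F Y - F X - <V, Y - X>) / ||Y - X|| >= 0 *)
Definition frechet_subdiff (R : realType) (n1 n2 n3 : nat)
  (F : tensor R n1 n2 n3 -> R) (X V : tensor R n1 n2 n3) : Prop :=
  forall eps : R, 0 < eps -> exists2 delta : R, 0 < delta &
    forall Y, tnorm (tsub Y X) < delta ->
      - (eps * tnorm (tsub Y X)) <= F Y - F X - tdot V (tsub Y X).

(* convergence of a sequence of tensors in the Frobenius norm *)
Definition tcvg (R : realType) (n1 n2 n3 : nat)
  (u : nat -> tensor R n1 n2 n3) (L : tensor R n1 n2 n3) : Prop :=
  tnorm (tsub (u t) L) @[t --> \oo] --> (0 : R).

(* limiting (Mordukhovich) subdifferential *)
Definition limiting_subdiff (R : realType) (n1 n2 n3 : nat)
  (F : tensor R n1 n2 n3 -> R) (X V : tensor R n1 n2 n3) : Prop :=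
  exists (Xs Vs : nat -> tensor R n1 n2 n3),
    [/\ tcvg Xs X, F (Xs t) @[t --> \oo] --> F X, tcvg Vs V &
        forall t, frechet_subdiff F (Xs t) (Vs t)].

(* ---------- assumptions, written out ---------- *)

(* rho' is the derivative of rho on [0, oo) (one-sided at 0) *)
Definition deriv_on_nonneg (R : realType) (rho rho' : R -> R) : Prop :=
  forall t, 0 <= t -> forall eps : R, 0 < eps -> exists2 delta : R, 0 < delta &
    forall s, 0 <= s -> `|s - t| < delta ->
      `|rho s - rho t - rho' t * (s - t)| <= eps * `|s - t|.

Definition concave_on_nonneg (R : realType) (rho : R -> R) : Prop :=
  forall x y a : R, 0 <= x -> 0 <= y -> 0 <= a <= 1 ->
    a * rho x + (1 - a) * rho y <= rho (a * x + (1 - a) * y).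

(* g is the gradient of f (Frechet differentiability w.r.t. the Frobenius
   norm and the entrywise inner product) *)
Definition is_gradient (R : realType) (n1 n2 n3 : nat)
  (f : tensor R n1 n2 n3 -> R) (g : tensor R n1 n2 n3 -> tensor R n1 n2 n3) : Prop :=
  forall X (eps : R), 0 < eps -> exists2 delta : R, 0 < delta &
    forall Y, tnorm (tsub Y X) < delta ->
      `|f Y - f X - tdot (g X) (tsub Y X)| <= eps * tnorm (tsub Y X).

(* ---------- the TNNR iteration ---------- *)
(* X^{t-1}, with the convention X^{-1} = X^0 *)
Definition Xprev (R : realType) (n1 n2 n3 : nat) (X : nat -> tensor R n1 n2 n3)
  (t : nat) : tensor R n1 n2 n3 :=
  if t is t'.+1 then X t' else X 0%N.

(* extrapolated point X^t + theta (X^t - X^{t-1}) *)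
Definition extrap (R : realType) (n1 n2 n3 : nat) (X : nat -> tensor R n1 n2 n3)
  (theta : nat -> R) (t : nat) : tensor R n1 n2 n3 :=
  tadd (X t) (tscale (theta t) (tsub (X t) (Xprev X t))).

(* weights alpha_k^t and beta_i^{k,t} *)
Definition alphaw (R : realType) (n1 n2 n3 : nat) (rho rho' : R -> R)
  (Xt : tensor R n1 n2 n3) (k : 'I_n3) : R :=
  rho' (\sum_(i < minn n1 n2) rho (rho (tsigma Xt k i))).
Definition betaw (R : realType) (n1 n2 n3 : nat) (rho rho' : R -> R)
  (Xt : tensor R n1 n2 n3) (k : 'I_n3) (i : nat) : R :=
  rho' (rho (tsigma Xt k i)).

(* the subproblem objective at step t *)
Definition subproblem (R : realType) (n1 n2 n3 : nat) (lam : R) (rho rho' : R -> R)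
  (gradf : tensor R n1 n2 n3 -> tensor R n1 n2 n3)
  (X : nat -> tensor R n1 n2 n3) (theta1 theta2 mu : nat -> R) (t : nat)
  (W : tensor R n1 n2 n3) : R :=
  let Y := extrap X theta1 t in
  let Z := extrap X theta2 t in
  lam * wnorm rho (alphaw rho rho' (X t)) (betaw rho rho' (X t)) W
  + tdot (tsub W Y) (gradf Z) + mu t / 2 * tnorm (tsub W Y) ^+ 2.

(* X is a sequence generated by the TNNR iteration: every X^{t+1} is a
   global minimizer of the step-t subproblem *)
Definition TNNR_sequence (R : realType) (n1 n2 n3 : nat) (lam : R) (rho rho' : R -> R)
  (gradf : tensor R n1 n2 n3 -> tensor R n1 n2 n3)
  (X : nat -> tensor R n1 n2 n3) (theta1 theta2 mu : nat -> R) : Prop :=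
  forall t W, subproblem lam rho rho' gradf X theta1 theta2 mu t (X t.+1)
              <= subproblem lam rho rho' gradf X theta1 theta2 mu t W.

(* Main.v *)
(* By concavity of rho, linearizing the two outer occurrences of rho at V bounds
   the penalty from above, with equality and the same first-order expansion at V:
   the weighted function with the weights of V is a first-order surrogate of the
   penalty. Such surrogates compose like derivatives, and singular values are
   Lipschitz by Weyl's inequality, so the surrogate is moreover continuous.

   For any objective P + f with such a surrogate of P, the descent lemma at the
   extrapolated points makes F(X^t) + (mu^t theta_1^t / 2) ||X^t - X^{t-1}||^2
   decrease by a multiple of ||X^{t+1} - X^t||^2, which gives (i), (ii) and
   X^{t+1} - X^t -> 0.

   For (iii) no subdifferential calculus for spectral functions is needed. The
   minimality of X^{t+1} passes to the limit: X_star minimizes its own proximal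
   model, which to first order is the objective up to a quadratic term, so 0 is
   even a Frechet subgradient of F at X_star. *)
Require Import Defs.
From mathcomp Require Import all_boot all_order all_algebra perm.
From mathcomp Require Import all_classical all_reals all_analysis.
From mathcomp Require Import complex.
From mathcomp Require Import ring lra.
Import Order.TTheory GRing.Theory Num.Theory.
Import numFieldNormedType.Exports.
Local Open Scope classical_set_scope.
Local Open Scope ring_scope.

Set Implicit Arguments.
Unset Strict Implicit.
Unset Printing Implicit Defensive.

Lemma lagrange_identity (R : comNzRingType) (I : finType) (a b : I -> R) :
  \sum_i \sum_j (a i * b j - a j * b i) ^+ 2 =
  2 * ((\sum_i a i ^+ 2) * (\sum_i b i ^+ 2) - (\sum_i a i * b i) ^+ 2).
Proof.
have -> : \sum_i \sum_j (a i * b j - a j * b i) ^+ 2 =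
    \sum_i \sum_j a i ^+ 2 * b j ^+ 2 + \sum_i \sum_j b i ^+ 2 * a j ^+ 2
    - 2 * \sum_i \sum_j a i * b i * (a j * b j).
  rewrite mulr_sumr -sumrN -!big_split/=; apply: eq_bigr => i _.
  rewrite mulr_sumr -sumrN -!big_split/=; apply: eq_bigr => j _.
  by ring.
by rewrite -!big_distrlr/=; ring.
Qed.

Section EuclideanNorm.
Variables (R : rcfType) (I : finType).
Implicit Types a b : I -> R.

Definition l2norm a : R := Num.sqrt (\sum_i a i ^+ 2).

Lemma sqr_l2norm a : l2norm a ^+ 2 = \sum_i a i ^+ 2.
Proof. by rewrite sqr_sqrtr// sumr_ge0// => i _; exact: sqr_ge0. Qed.

Lemma normr_le_l2norm a i : `|a i| <= l2norm a.
Proof.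
rewrite -sqrtr_sqr ler_wsqrtr// (bigD1 i)//= lerDl.
by apply: sumr_ge0 => j _; exact: sqr_ge0.
Qed.

Lemma ler_l2norm a b : (forall i, `|a i| <= `|b i|) -> l2norm a <= l2norm b.
Proof.
move=> ab; apply: ler_wsqrtr; apply: ler_sum => i _.
rewrite -(real_normK (num_real (a i))) -(real_normK (num_real (b i))).
by rewrite ler_sqr ?nnegrE.
Qed.

Lemma l2norm_le_sum a : l2norm a <= \sum_i `|a i|.
Proof.
have S_ge0 : 0 <= \sum_i `|a i| by apply: sumr_ge0.
rewrite -ler_sqr ?nnegrE ?sqrtr_ge0// sqr_l2norm expr2 mulr_suml.
apply: ler_sum => i _; rewrite -real_normK ?num_real// expr2 ler_wpM2l//.
by rewrite (bigD1 i)//= lerDl sumr_ge0.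
Qed.

Lemma cauchy_schwarz a b : \sum_i a i * b i <= l2norm a * l2norm b.
Proof.
rewrite (le_trans (ler_norm _))//.
rewrite -ler_sqr ?nnegrE ?mulr_ge0 ?sqrtr_ge0// exprMn !sqr_l2norm.
rewrite real_normK ?num_real// -subr_ge0 -(pmulr_rge0 _ (ltr0n _ 2)).
rewrite -lagrange_identity; apply: sumr_ge0 => i _; apply: sumr_ge0 => j _.
exact: sqr_ge0.
Qed.

Lemma l2normD_le a b : l2norm (fun i => a i + b i) <= l2norm a + l2norm b.
Proof.
rewrite -ler_sqr ?nnegrE ?addr_ge0 ?sqrtr_ge0// sqrrD !sqr_l2norm.
have -> : \sum_i (a i + b i) ^+ 2 =
    \sum_i a i ^+ 2 + (\sum_i a i * b i) *+ 2 + \sum_i b i ^+ 2.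
  by rewrite -sumrMnl -!big_split/=; apply: eq_bigr => i _; ring.
by rewrite lerD2r lerD2l lerMn2r/= cauchy_schwarz.
Qed.

End EuclideanNorm.

Section FrobeniusNorm.
Variable R : rcfType.
Local Notation C := R[i].
Local Notation normc := (@ComplexField.Normc.normc R).

Lemma normc_ge0 (z : C) : 0 <= normc z.
Proof. by case: z => x y; exact: sqrtr_ge0. Qed.

Lemma normc_sum_le (I : finType) (z : I -> C) :
  normc (\sum_i z i) <= \sum_i normc (z i).
Proof.
elim/big_ind2 : _ => //; first by rewrite ComplexField.Normc.normc0.
by move=> x1 x2 y1 y2 h1 h2; apply: le_trans (le_normcD _ _) (lerD h1 h2).
Qed.

Definition frob (m n : nat) (A : 'M[C]_(m, n)) : R :=
  l2norm (fun p : 'I_m * 'I_n => normc (A p.1 p.2)).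

Section MatrixNorm.
Variables m n : nat.
Implicit Types A B : 'M[C]_(m, n).

Lemma frobE A : frob A = Num.sqrt (\sum_i \sum_j normc (A i j) ^+ 2).
Proof. by rewrite pair_big. Qed.

Lemma frob_ge0 A : 0 <= frob A.
Proof. exact: sqrtr_ge0. Qed.

Lemma sqr_frob A : frob A ^+ 2 = \sum_i \sum_j normc (A i j) ^+ 2.
Proof. by rewrite sqr_l2norm pair_big. Qed.

Lemma frob_gt0 A : A != 0 -> 0 < frob A.
Proof.
apply: contra_neqT; rewrite -leNgt => A_le0; apply/matrixP => i j; rewrite mxE.
apply: ComplexField.Normc.eq0_normc; apply/eqP.
rewrite -normr_le0 (le_trans _ A_le0)//.
exact: (normr_le_l2norm (fun p => normc (A p.1 p.2)) (i, j)).
Qed.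

Lemma frobD_le A B : frob (A + B) <= frob A + frob B.
Proof.
apply: le_trans (l2normD_le _ _); apply: ler_l2norm => p.
by rewrite !ger0_norm ?addr_ge0 ?normc_ge0// mxE le_normcD.
Qed.

Lemma frobN A : frob (- A) = frob A.
Proof. by rewrite !frobE; under eq_bigr do under eq_bigr do rewrite mxE normcN. Qed.

End MatrixNorm.

Lemma sqr_frob_row (n : nat) (x : 'rV[C]_n) :
  frob x ^+ 2 = \sum_j normc (x 0 j) ^+ 2.
Proof. by rewrite sqr_frob big_ord1. Qed.

Lemma frob_mul_row_le (m n : nat) (x : 'rV[C]_m) (A : 'M[C]_(m, n)) :
  frob (x *m A) <= frob x * frob A.
Proof.
rewrite -ler_sqr ?nnegrE ?mulr_ge0 ?frob_ge0// exprMn !sqr_frob_row sqr_frob.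
rewrite exchange_big/= mulr_sumr; apply: ler_sum => j _.
have entry_le : normc ((x *m A) 0 j) <=
    l2norm (fun k => normc (x 0 k)) * l2norm (fun k => normc (A k j)).
  rewrite mxE; apply: le_trans (normc_sum_le _) (le_trans _ (cauchy_schwarz _ _)).
  by apply: ler_sum => k _; rewrite ComplexField.Normc.normcM.
by rewrite -!sqr_l2norm -exprMn ler_sqr ?nnegrE ?mulr_ge0 ?normc_ge0 ?sqrtr_ge0.
Qed.

End FrobeniusNorm.

Section ConjugateTranspose.
Variable R : realType.
Local Notation C := R[i].

Lemma conjTE (m n : nat) (A : 'M[C]_(m, n)) : conjT A = map_mx Num.conj A^T.
Proof. by apply/matrixP => i j; rewrite !mxE. Qed.

Lemma conjTK (m n : nat) (A : 'M[C]_(m, n)) : conjT (conjT A) = A.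
Proof. by rewrite !conjTE trmxCK. Qed.

Lemma conjTM (m n p : nat) (A : 'M[C]_(m, n)) (B : 'M[C]_(n, p)) :
  conjT (A *m B) = conjT B *m conjT A.
Proof. by rewrite /conjT map_mxM trmx_mul. Qed.

Lemma conjTB (m n : nat) (A B : 'M[C]_(m, n)) :
  conjT (A - B) = conjT A - conjT B.
Proof. by rewrite /conjT map_mxB linearB. Qed.

Lemma frob_conjT (m n : nat) (A : 'M[C]_(m, n)) : frob (conjT A) = frob A.
Proof.
rewrite !frobE exchange_big/=; congr Num.sqrt.
apply: eq_bigr => i _; apply: eq_bigr => j _; rewrite !mxE.
by case: (A i j) => x y /=; rewrite sqrrN.
Qed.

Lemma mul_row_conjT (n : nat) (x : 'rV[C]_n) :
  (x *m conjT x) 0 0 = ((frob x ^+ 2)%:C)%C.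
Proof.
rewrite sqr_frob_row mxE rmorph_sum/=; apply: eq_bigr => j _.
by rewrite !mxE -sqr_normc rmorphXn.
Qed.

Lemma sqr_frob_mul_conjT (m n : nat) (x : 'rV[C]_n) (A : 'M[C]_(m, n)) :
  ((frob (x *m conjT A) ^+ 2)%:C)%C = (x *m (conjT A *m A) *m conjT x) 0 0.
Proof. by rewrite -mul_row_conjT conjTM conjTK !mulmxA. Qed.

Lemma frob_mul_unitary (n : nat) (x : 'rV[C]_n) (Q : 'M[C]_n) :
  Q \is unitarymx -> frob (x *m Q) = frob x.
Proof.
move=> Qu; have QQ : Q *m conjT Q = 1%:M by rewrite conjTE; apply/unitarymxP.
apply/eqP; rewrite -(eqrXn2 (ltn0Sn 1)) ?frob_ge0//; apply/eqP/complexI.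
by rewrite -[Q in LHS]conjTK sqr_frob_mul_conjT conjTK QQ mulmx1 mul_row_conjT.
Qed.

End ConjugateTranspose.

Lemma char_poly_similar (F : fieldType) (n : nat) (P M : 'M[F]_n) :
  P \in unitmx -> char_poly (invmx P *m M *m P) = char_poly M.
Proof.
move=> Pu; rewrite /char_poly /char_poly_mx !map_mxM/=.
have PQ : map_mx polyC (invmx P) *m map_mx polyC P = 1%:M.
  by rewrite -map_mxM mulVmx// map_mx1.
have {1}-> : 'X%:M = map_mx polyC (invmx P) *m 'X%:M *m map_mx polyC P.
  by rewrite scalar_mxC -mulmxA PQ mulmx1.
by rewrite -mulmxBl -mulmxBr !det_mulmx mulrAC -det_mulmx PQ det1 mul1r.
Qed.

Lemma perm_eigenvalues_spectral_diag (C : numClosedFieldType) (n : nat) (M : 'M[C]_n) :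
  M \is normalmx ->
  perm_eq (eigenvalues M) [seq spectral_diag M 0 j | j <- enum 'I_n].
Proof.
move=> /orthomx_spectralP M_spectral; apply: prod_XsubC_eq.
rewrite /eigenvalues -(eqP (xchooseP (char_poly_split M))).
rewrite [in LHS]M_spectral char_poly_similar ?spectral_unit// char_poly_trig.
  by rewrite big_map -big_enum/=; apply: eq_bigr => j _; rewrite mxE eqxx mulr1n.
exact/is_diag_mx_is_trig/diag_mx_is_diag.
Qed.

Lemma row_kernel_neq0 (F : fieldType) (m n : nat) (K : 'M[F]_(n, m)) :
  (m < n)%N -> exists2 x : 'rV_n, x != 0 & x *m K = 0.
Proof.
move=> mn; have : kermx K != 0.
  rewrite -mxrank_eq0 mxrank_ker subn_eq0 -ltnNge.
  exact: leq_ltn_trans (rank_leq_col K) mn.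
by move=> /rowV0Pn[x /sub_kermxP xK x0]; exists x.
Qed.

Lemma vanishing_coords_neq0 (F : fieldType) (n : nat) (P Q : 'M[F]_n)
    (S T : {pred 'I_n}) : (#|S| + #|T| < n)%N ->
  exists2 x : 'rV_n, x != 0 &
    {in S, forall j, (x *m P) 0 j = 0} /\ {in T, forall j, (x *m Q) 0 j = 0}.
Proof.
pose cols (U : {pred 'I_n}) M := colsub (enum_val (A := U)) M : 'M[F]_(n, _).
have cols0 (U : {pred 'I_n}) M (x : 'rV_n) :
    x *m cols U M = 0 -> {in U, forall j, (x *m M) 0 j = 0}.
  move=> /matrixP xM j Uj; have := xM 0 (enum_rank_in Uj j).
  by rewrite mulmx_colsub !mxE enum_rankK_in// mxE.
move=> /(row_kernel_neq0 (row_mx (cols S P) (cols T Q)))[x x0].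
rewrite mul_mx_row -[X in _ = X]row_mx0 => /eq_row_mx[xP xQ].
by exists x => //; split; exact: cols0.
Qed.

Lemma card_ord_gt_lt (n : nat) (i : 'I_n) :
  (#|[pred j : 'I_n | i < j]| + #|[pred j : 'I_n | j < i]| = n.-1)%N.
Proof.
set S := [pred j | _]; set T := [pred j | _].
rewrite -cardUI (@eq_card0 _ [predI S & T]) ?addn0; last first.
  by move=> j; rewrite !inE; case: ltngtP.
rewrite (@eq_card _ [predU S & T] (predC1 i)) ?cardC1 ?card_ord//.
by move=> j; rewrite !inE -neq_ltn eq_sym.
Qed.

Section SingularValues.
Variables (R : realType) (m n : nat).
Local Notation C := R[i].
Local Notation normc := (@ComplexField.Normc.normc R).
Implicit Types (A B : 'M[C]_(m, n)) (x : 'rV[C]_n).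

Lemma gram_normal A : conjT A *m A \is normalmx.
Proof. by apply/normalmxP; rewrite -conjTE conjTM conjTK. Qed.

Definition gram_spectralmx A : 'M[C]_n := spectralmx (conjT A *m A).

Definition gram_spectral_norm A (j : 'I_n) : R :=
  frob (row j (gram_spectralmx A) *m conjT A).

Lemma gram_spectralE A : conjT A *m A =
  conjT (gram_spectralmx A) *m diag_mx (spectral_diag (conjT A *m A))
  *m gram_spectralmx A.
Proof.
rewrite [LHS](orthomx_spectralP (gram_normal A)) invmx_unitary -?conjTE//.
exact: spectral_unitarymx.
Qed.

Lemma gram_spectral_diagE A j : spectral_diag (conjT A *m A) 0 j =
  ((gram_spectral_norm A j ^+ 2)%:C)%C.
Proof.
set Q := gram_spectralmx A; set d := spectral_diag _.
have QQ : Q *m conjT Q = 1%:M.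
  by rewrite conjTE; apply/unitarymxP; exact: spectral_unitarymx.
have -> : d 0 j = (Q *m (conjT A *m A) *m conjT Q) j j.
  rewrite gram_spectralE -/Q -/d !mulmxA QQ mul1mx -mulmxA QQ mulmx1.
  by rewrite mxE eqxx mulr1n.
rewrite sqr_frob_mul_conjT -row_mul !mxE.
by apply: eq_bigr => k _; rewrite !mxE.
Qed.

Lemma sqr_frob_mul_gram_spectral A x : frob (x *m conjT A) ^+ 2 =
  \sum_j (gram_spectral_norm A j *
          normc ((x *m conjT (gram_spectralmx A)) 0 j)) ^+ 2.
Proof.
apply: complexI; rewrite sqr_frob_mul_conjT gram_spectralE.
set Q := gram_spectralmx A; set d := spectral_diag _.
have -> : x *m (conjT Q *m diag_mx d *m Q) *m conjT x =
    x *m conjT Q *m diag_mx d *m conjT (x *m conjT Q).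
  by rewrite conjTM conjTK !mulmxA.
rewrite mxE rmorph_sum; apply: eq_bigr => j _.
rewrite mul_mx_diag !mxE gram_spectral_diagE exprMn.
rewrite [RHS](rmorphM (real_complex R)) [RHS]mulrC mulrAC; congr (_ * _).
by rewrite -sqr_normc rmorphXn.
Qed.

Lemma perm_singvals A :
  perm_eq (singvals A) [seq gram_spectral_norm A j | j <- enum 'I_n].
Proof.
rewrite /singvals perm_sort.
apply: (perm_trans (perm_map _ (perm_eigenvalues_spectral_diag (gram_normal A)))).
rewrite -map_comp; under eq_map => j
  do rewrite /= gram_spectral_diagE /= sqrtr_sqr ger0_norm ?frob_ge0//.
exact: perm_refl.
Qed.

Lemma singval_ge0 A i : 0 <= singval A i.
Proof.
rewrite /singval; have [ltis|] := ltnP i (size (singvals A)); last first.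
  by move=> ?; rewrite nth_default.
have := mem_nth 0 ltis; rewrite (perm_mem (perm_singvals A)) => /mapP[j _ ->].
exact: frob_ge0.
Qed.

Lemma singval_noninc A (i j : 'I_n) : (i <= j)%N -> singval A j <= singval A i.
Proof.
have size_singvals : size (singvals A) = n.
  by rewrite (perm_size (perm_singvals A)) size_map size_enum_ord.
apply: (sorted_leq_nth (leT := fun x y : R => y <= x)); rewrite ?inE ?size_singvals//.
- by move=> x y z xy yz; exact: le_trans xy.
- by apply: sort_sorted => x y; exact: le_total.
Qed.

(* P is unitary and its columns are eigenvectors of A^* A, in the order of the
   singular values; the two norm identities are all that Weyl's inequality needs. *)
Definition right_singular_basis A (P : 'M[C]_n) : Prop :=
  (forall x, frob (x *m P) = frob x) /\
  (forall x, frob (x *m conjT A) ^+ 2 =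
     \sum_(j < n) (singval A j * normc ((x *m P) 0 j)) ^+ 2).

Lemma right_singular_basis_exists A : exists P, right_singular_basis A P.
Proof.
have /tuple_permP[s singvalsE] :
    perm_eq (singvals A) [tuple gram_spectral_norm A j | j < n].
  exact: perm_singvals.
have singvalE (j : 'I_n) : singval A j = gram_spectral_norm A (s j).
  by rewrite /singval singvalsE -tnth_nth !tnth_mktuple.
set Q := gram_spectralmx A.
have coordE x j : (x *m col_perm s (conjT Q)) 0 j = (x *m conjT Q) 0 (s j).
  by rewrite !mxE; apply: eq_bigr => k _; rewrite !mxE.
exists (col_perm s (conjT Q)); split=> x.
  rewrite -[RHS](@frob_mul_unitary _ _ _ (conjT Q)); last first.
    by rewrite conjTE trmxC_unitary spectral_unitarymx.
  rewrite !frobE !big_ord1 [in RHS](reindex_perm s); congr Num.sqrt.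
  by apply: eq_bigr => j _; rewrite coordE.
rewrite sqr_frob_mul_gram_spectral (reindex_perm s).
by apply: eq_bigr => j _; rewrite singvalE coordE.
Qed.

Section CoordinateSubspaces.
Variables (A : 'M[C]_(m, n)) (P : 'M[C]_n) (i : 'I_n) (x : 'rV[C]_n).
Hypothesis AP : right_singular_basis A P.

Lemma singval_frob_le : (forall j : 'I_n, (i < j)%N -> (x *m P) 0 j = 0) ->
  singval A i * frob x <= frob (x *m conjT A).
Proof.
case: AP => Piso APE xP.
rewrite -ler_sqr ?nnegrE ?mulr_ge0 ?frob_ge0 ?singval_ge0//.
rewrite APE -Piso exprMn sqr_frob_row mulr_sumr; apply: ler_sum => j _.
rewrite -exprMn; have [ij|ji] := ltnP i j.
  by rewrite xP// ComplexField.Normc.normc0 !mulr0.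
rewrite ler_sqr ?nnegrE ?mulr_ge0 ?normc_ge0 ?singval_ge0//.
by rewrite ler_wpM2r ?normc_ge0 ?singval_noninc.
Qed.

Lemma frob_le_singval : (forall j : 'I_n, (j < i)%N -> (x *m P) 0 j = 0) ->
  frob (x *m conjT A) <= singval A i * frob x.
Proof.
case: AP => Piso APE xP.
rewrite -ler_sqr ?nnegrE ?mulr_ge0 ?frob_ge0 ?singval_ge0//.
rewrite APE -Piso exprMn sqr_frob_row mulr_sumr; apply: ler_sum => j _.
rewrite -exprMn; have [ji|ij] := ltnP j i.
  by rewrite xP// ComplexField.Normc.normc0 !mulr0.
rewrite ler_sqr ?nnegrE ?mulr_ge0 ?normc_ge0 ?singval_ge0//.
by rewrite ler_wpM2r ?normc_ge0 ?singval_noninc.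
Qed.

End CoordinateSubspaces.

(* The n - 1 linear conditions of the two coordinate subspaces have a common
   nonzero solution x, on which A is large and B is small. *)
Lemma singval_perturbation A B (i : 'I_n) :
  singval A i <= singval B i + frob (A - B).
Proof.
have [P AP] := right_singular_basis_exists A.
have [Q BQ] := right_singular_basis_exists B.
pose S := [pred j : 'I_n | (i < j)%N]; pose T := [pred j : 'I_n | (j < i)%N].
have ST : (#|S| + #|T| < n)%N.
  by rewrite card_ord_gt_lt prednK// (leq_trans _ (ltn_ord i)).
have [x x_neq0 [xP xQ]] := vanishing_coords_neq0 P Q ST.
rewrite -(ler_pM2r (frob_gt0 x_neq0)).
have A_large : singval A i * frob x <= frob (x *m conjT A).
  by apply: (singval_frob_le AP) => j ij; apply: xP; rewrite inE.
have B_small : frob (x *m conjT B) <= singval B i * frob x.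
  by apply: (frob_le_singval BQ) => j ji; apply: xQ; rewrite inE.
apply: (le_trans A_large); rewrite mulrDl.
have -> : x *m conjT A = x *m conjT B + x *m conjT (A - B).
  by rewrite -mulmxDr conjTB addrC subrK.
apply: (le_trans (frobD_le _ _)); rewrite lerD// mulrC -(frob_conjT (A - B)).
exact: frob_mul_row_le.
Qed.

Lemma singval_lipschitz A B i :
  (i < n)%N -> `|singval A i - singval B i| <= frob (A - B).
Proof.
move=> ltin.
have AB : singval A i <= singval B i + frob (A - B).
  exact: (singval_perturbation A B (Ordinal ltin)).
have BA : singval B i <= singval A i + frob (A - B).
  by rewrite -frobN opprB; exact: (singval_perturbation B A (Ordinal ltin)).
rewrite ler_distl lerBlDr; exact/andP/(conj BA AB).
Qed.

End SingularValues.

Section RealSequences.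
Variable R : realType.

Lemma cvgr_dist_le (u e : nat -> R) (l C : R) :
  (forall t, `|u t - l| <= C * e t) -> e t @[t --> \oo] --> 0 ->
  u t @[t --> \oo] --> l.
Proof.
move=> u_le e0; apply/subr_cvg0/norm_cvg0P.
apply: (@squeeze_cvgr _ _ _ _ (fun=> 0) (fun t => C * e t)).
- by near=> t; rewrite normr_ge0 u_le.
- exact: cvg_cst.
- by rewrite -(mulr0 C); apply: cvgM => //; exact: cvg_cst.
Unshelve. all: by end_near. Qed.

Lemma cvgr_sum (I : Type) (r : seq I) (P : pred I) (u : I -> nat -> R) (l : I -> R) :
  (forall i, P i -> u i t @[t --> \oo] --> l i) ->
  \sum_(i <- r | P i) u i t @[t --> \oo] --> \sum_(i <- r | P i) l i.
Proof. by apply: cvg_big; exact: add_continuous. Qed.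

Lemma sqr_cvg0 (u : nat -> R) :
  u t ^+ 2 @[t --> \oo] --> 0 -> u t @[t --> \oo] --> 0.
Proof.
move=> u2_cvg0; apply/norm_cvg0P.
have : Num.sqrt (u t ^+ 2) @[t --> \oo] --> Num.sqrt (0 : R).
  by apply: (continuous_cvg _ _ u2_cvg0); exact: sqrt_continuous.
by rewrite sqrtr0; under eq_fun do rewrite sqrtr_sqr.
Qed.

Lemma sufficient_decrease_cvg (E a : nat -> R) (c m : R) :
  0 < c -> (forall t, 0 <= a t) -> (forall t, m <= E t) ->
  (forall t, E t.+1 + c * a t <= E t) ->
  cvgn E /\ a t @[t --> \oo] --> 0.
Proof.
move=> c0 a0 Em E_decr.
have E_cvg : cvgn E.
  apply: nonincreasing_is_cvgn; last by exists m => _ [t _ <-].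
  apply/nonincreasing_seqP => t; apply: le_trans (E_decr t).
  by rewrite lerDl mulr_ge0// ltW.
split=> //; apply: (@cvgr_dist_le _ (fun t => E t - E t.+1) _ c^-1).
  by move=> t; rewrite subr0 ger0_norm// mulrC ler_pdivlMr// mulrC lerBrDl.
by rewrite -(subrr (limn E)); apply: cvgB; rewrite ?(cvg_shiftS E).
Qed.

Lemma strictly_increasing_cvgny (phi : nat -> nat) :
  {homo phi : m n / (m < n)%N} -> phi l @[l --> \oo] --> \oo.
Proof.
move=> phi_inc; apply/cvgnyPge => A; exists A => // n /= An.
by apply: leq_trans An _; elim: n => // n /leq_ltn_trans; apply; exact: phi_inc.
Qed.

Lemma cvgn_subseq (u : nat -> R) (phi : nat -> nat) (l : R) :
  {homo phi : m n / (m < n)%N} -> u t @[t --> \oo] --> l ->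
  u (phi t) @[t --> \oo] --> l.
Proof. by move=> /strictly_increasing_cvgny phi_y; exact: cvg_comp. Qed.

Lemma bolzano_weierstrass_family (I : finType) (u : nat -> I -> R) (B : R) :
  (forall t i, `|u t i| <= B) ->
  exists2 phi : nat -> nat, {homo phi : m n / (m < n)%N} &
    forall i, cvgn (fun l => u (phi l) i).
Proof.
move=> uB.
suff /(_ (enum I))[phi phi_inc u_cvg] : forall s : seq I,
    exists2 phi : nat -> nat, {homo phi : m n / (m < n)%N} &
    {in s, forall i, cvgn (fun l => u (phi l) i)}.
  by exists phi => // i; apply: u_cvg; rewrite mem_enum.
elim=> [|i s [phi phi_inc u_cvg]]; first by exists id.
have [|psi psi_mono ui_cvg] := @bolzano_weierstrass _ (fun l => u (phi l) i).
  exists B; split=> [|M /ltW BM t _]; first exact: num_real.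
  exact: le_trans (uB _ _) BM.
have psi_inc : {homo psi : m n / (m < n)%N}.
  by move=> m n mn; have := leW_mono psi_mono m n; rewrite /Order.lt /= => ->.
exists (phi \o psi) => [m n mn|j]; first exact/phi_inc/psi_inc.
rewrite inE => /predU1P[->//|/u_cvg uj_cvg].
by apply/cvg_ex; exists (limn (fun l => u (phi l) j)); exact: cvgn_subseq uj_cvg.
Qed.

End RealSequences.

Lemma tensorP (R : realType) (n1 n2 n3 : nat) (X Y : tensor R n1 n2 n3) :
  (forall k i j, X k i j = Y k i j) -> X = Y.
Proof. by move=> XY; apply/funext => k; apply/matrixP => i j. Qed.

Ltac tensor_ring := apply: tensorP => ? ? ?; rewrite !mxE; ring.

Section Tensors.
Variables (R : realType) (n1 n2 n3 : nat).
Local Notation T := (tensor R n1 n2 n3).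
Local Notation idx := ('I_n3 * ('I_n1 * 'I_n2))%type.
Implicit Types X Y Z : T.

Definition tentry X (p : idx) : R := X p.1 p.2.1 p.2.2.

Lemma tdotE X Y : tdot X Y = \sum_p tentry X p * tentry Y p.
Proof.
rewrite -(pair_bigA _ (fun k q => X k q.1 q.2 * Y k q.1 q.2))/=.
by apply: eq_bigr => k _; rewrite pair_bigA.
Qed.

Lemma tnormE X : tnorm X = l2norm (tentry X).
Proof. by rewrite /tnorm tdotE; under eq_bigr do rewrite -expr2. Qed.

Lemma tnorm_ge0 X : 0 <= tnorm X.
Proof. exact: sqrtr_ge0. Qed.

Lemma sqr_tnorm X : tnorm X ^+ 2 = tdot X X.
Proof. by rewrite tnormE sqr_l2norm tdotE; under eq_bigr do rewrite expr2. Qed.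

Lemma tdot_ge0 X : 0 <= tdot X X.
Proof. by rewrite -sqr_tnorm sqr_ge0. Qed.

Lemma tdotC X Y : tdot X Y = tdot Y X.
Proof. by rewrite !tdotE; apply: eq_bigr => p _; rewrite mulrC. Qed.

Lemma tdotBl X Y Z : tdot (tsub X Y) Z = tdot X Z - tdot Y Z.
Proof.
by rewrite !tdotE -sumrB; apply: eq_bigr => p _; rewrite /tentry !mxE mulrBl.
Qed.

Lemma tdotBr X Y Z : tdot Z (tsub X Y) = tdot Z X - tdot Z Y.
Proof. by rewrite tdotC tdotBl !(tdotC Z). Qed.

Lemma tdotZl a X Y : tdot (tscale a X) Y = a * tdot X Y.
Proof.
by rewrite !tdotE mulr_sumr; apply: eq_bigr => p _; rewrite /tentry !mxE mulrA.
Qed.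

Lemma tdotZr a X Y : tdot Y (tscale a X) = a * tdot Y X.
Proof. by rewrite tdotC tdotZl (tdotC Y). Qed.

Lemma tdot0l X : tdot (@tzero R n1 n2 n3) X = 0.
Proof. by rewrite tdotE big1// => p _; rewrite /tentry mxE mul0r. Qed.

Lemma tdot_le X Y : tdot X Y <= tnorm X * tnorm Y.
Proof. by rewrite tdotE !tnormE cauchy_schwarz. Qed.

Lemma tdot_young X Y : 2 * tdot X Y <= tdot X X + tdot Y Y.
Proof.
have := tdot_ge0 (tsub X Y); rewrite !(tdotBl, tdotBr) (tdotC Y X).
by move: (tdot _ _) (tdot _ _) (tdot _ _) => *; lra.
Qed.

Lemma tnormZ a X : tnorm (tscale a X) = `|a| * tnorm X.
Proof.
by rewrite /tnorm tdotZl tdotZr mulrA -expr2 sqrtrM ?sqr_ge0// sqrtr_sqr.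
Qed.

Lemma tnorm_subxx X : tnorm (tsub X X) = 0.
Proof. by rewrite /tnorm tdotBl subrr sqrtr0. Qed.

Lemma tnorm_distD Z X Y : tnorm (tsub X Y) <= tnorm (tsub X Z) + tnorm (tsub Z Y).
Proof.
rewrite !tnormE (le_trans _ (l2normD_le _ _))// ler_l2norm// => p.
by rewrite /tentry !mxE addrA subrK.
Qed.

Lemma tnorm_le_sum X : tnorm X <= \sum_p `|tentry X p|.
Proof. by rewrite tnormE l2norm_le_sum. Qed.

Lemma tentry_le_tnorm X k i j : `|X k i j| <= tnorm X.
Proof. by rewrite tnormE; exact: (normr_le_l2norm (tentry X) (k, (i, j))). Qed.

Section Convergence.
Implicit Types u v : nat -> T.

Lemma tcvg_entryP u X :
  tcvg u X <-> (forall k i j, u t k i j @[t --> \oo] --> X k i j).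
Proof.
split=> [uX k i j|uX].
  apply: (@cvgr_dist_le _ _ (fun t => tnorm (tsub (u t) X)) _ 1) => // t.
  by rewrite mul1r; have := tentry_le_tnorm (tsub (u t) X) k i j; rewrite !mxE.
apply: (@cvgr_dist_le _ _ (fun t => \sum_p `|tentry (tsub (u t) X) p|) _ 1).
  by move=> t; rewrite mul1r subr0 ger0_norm ?tnorm_ge0 ?tnorm_le_sum.
have : \sum_p `|tentry (tsub (u t) X) p| @[t --> \oo] --> \sum_(p : idx) (0 : R).
  apply: cvgr_sum => p _; apply/norm_cvg0P.
  by under eq_fun do rewrite /tentry !mxE; exact/subr_cvg0/uX.
by rewrite big1.
Qed.

Lemma tcvg_cst X : tcvg (fun=> X) X.
Proof. by rewrite /tcvg tnorm_subxx; exact: cvg_cst. Qed.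

Lemma tcvgB u v X Y :
  tcvg u X -> tcvg v Y -> tcvg (fun t => tsub (u t) (v t)) (tsub X Y).
Proof.
move=> /tcvg_entryP uX /tcvg_entryP vY; apply/tcvg_entryP => k i j.
by under eq_fun do rewrite !mxE; rewrite !mxE; exact: cvgB.
Qed.

Lemma tdot_cvg u v X Y : tcvg u X -> tcvg v Y ->
  tdot (u t) (v t) @[t --> \oo] --> tdot X Y.
Proof.
move=> /tcvg_entryP uX /tcvg_entryP vY.
under eq_fun do rewrite tdotE; rewrite tdotE.
by apply: cvgr_sum => p _; apply: cvgM; [exact: uX|exact: vY].
Qed.

Lemma tcvg_dist0 u v X : tcvg u X ->
  tnorm (tsub (v t) (u t)) @[t --> \oo] --> (0 : R) -> tcvg v X.
Proof.
move=> uX vu; rewrite /tcvg.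
apply: (@cvgr_dist_le _ _
  (fun t => tnorm (tsub (v t) (u t)) + tnorm (tsub (u t) X)) _ 1).
  by move=> t; rewrite mul1r subr0 ger0_norm ?tnorm_ge0// tnorm_distD.
by rewrite -(addr0 0); exact: cvgD.
Qed.

Lemma tensor_bolzano_weierstrass u (B : R) : (forall t, tnorm (u t) <= B) ->
  exists X (phi : nat -> nat), {homo phi : m n / (m < n)%N} /\
    tcvg (fun l => u (phi l)) X.
Proof.
move=> uB.
have [t p|phi phi_inc u_cvg] := @bolzano_weierstrass_family _ _ (tentry \o u) B.
  exact: le_trans (tentry_le_tnorm _ _ _ _) (uB t).
exists (fun k => \matrix_(i, j) limn (fun l => u (phi l) k i j)), phi.
by split=> //; apply/tcvg_entryP => k i j; rewrite mxE; exact: (u_cvg (k, (i, j))).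
Qed.

End Convergence.

Lemma normc_dft_omegaX (n m : nat) :
  ComplexField.Normc.normc (dft_omega R n ^+ m) = 1.
Proof.
elim: m => [|m IH]; first by rewrite expr0 ComplexField.Normc.normc1.
by rewrite exprS ComplexField.Normc.normcM IH mulr1 /= sqrrN cos2Dsin2 sqrtr1.
Qed.

Lemma tdftB X Y k : tdft (tsub X Y) k = tdft X k - tdft Y k.
Proof.
apply/matrixP => i j; rewrite !mxE -sumrB; apply: eq_bigr => q _.
by rewrite -mulrBr -rmorphB !mxE.
Qed.

Lemma normc_tdft_le X k i j :
  ComplexField.Normc.normc (tdft X k i j) <= n3%:R * tnorm X.
Proof.
rewrite mxE (le_trans (normc_sum_le _))//.
rewrite -[X in X%:R * _]card_ord mulr_natl -sumr_const; apply: ler_sum => q _.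
rewrite ComplexField.Normc.normcM normc_dft_omegaX mul1r /=.
by rewrite expr0n /= addr0 sqrtr_sqr tentry_le_tnorm.
Qed.

Lemma frob_tdft_le X k : frob (tdft X k) <= (n1 * n2 * n3)%:R * tnorm X.
Proof.
apply: (le_trans (l2norm_le_sum _)); rewrite natrM -mulrA.
have -> : (n1 * n2)%N = #|{: 'I_n1 * 'I_n2}| by rewrite card_prod !card_ord.
rewrite mulr_natl -sumr_const; apply: ler_sum => p _.
by rewrite ger0_norm ?normc_ge0 ?normc_tdft_le.
Qed.

Lemma tsigma_ge0 X k i : 0 <= tsigma X k i.
Proof. exact: singval_ge0. Qed.

Lemma tsigma_lipschitz X Y k i : (i < minn n1 n2)%N ->
  `|tsigma X k i - tsigma Y k i| <= (n1 * n2 * n3)%:R * tnorm (tsub X Y).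
Proof.
rewrite leq_min => /andP[_ i_lt]; apply: (le_trans (singval_lipschitz _ _ i_lt)).
by rewrite -tdftB frob_tdft_le.
Qed.

End Tensors.

Section ConcaveFunction.
Variables (R : realType) (rho rho' : R -> R).
Hypothesis rho_deriv : deriv_on_nonneg rho rho'.
Hypothesis rho_concave : concave_on_nonneg rho.

Lemma concave_chord_le (a b l : R) : 0 <= a -> 0 <= b -> 0 <= l <= 1 ->
  l * (rho b - rho a) <= rho (a + l * (b - a)) - rho a.
Proof.
move=> a0 b0 l01; have := rho_concave b0 a0 l01.
have -> : l * b + (1 - l) * a = a + l * (b - a) by ring.
by move: (rho (_ + _)) => r; lra.
Qed.

Lemma concave_tangent (a b : R) : 0 <= a -> 0 <= b ->
  rho b - rho a <= rho' a * (b - a).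
Proof.
move=> a0 b0; apply/ler_addgt0Pr => e e0.
have [->|ba] := eqVneq b a; first by rewrite !subrr mulr0 add0r ltW.
have ba0 : 0 < `|b - a| by rewrite normr_gt0 subr_eq0.
have [d d0 rho_near_a] := rho_deriv a0 (divr_gt0 e0 ba0).
pose l := Num.min 1 (d / 2 / `|b - a|).
have l0 : 0 < l by rewrite lt_min ltr01 !divr_gt0.
have l01 : 0 <= l <= 1 by rewrite (ltW l0) ge_min lexx.
have l_lt_d : l * `|b - a| < d.
  apply: (@le_lt_trans _ _ (d / 2)); last by lra.
  by rewrite -ler_pdivlMr// ge_min lexx orbT.
pose s := a + l * (b - a).
have s0 : 0 <= s by have -> : s = l * b + (1 - l) * a by [rewrite /s; ring]; nra.
have sa : s - a = l * (b - a) by rewrite /s; ring.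
have := rho_near_a s s0; rewrite sa normrM (gtr0_norm l0) => /(_ l_lt_d).
rewrite [_ / _ * _]mulrCA divfK ?gt_eqF// ler_norml => /andP[_ rho_s_le].
rewrite -(ler_pM2l l0) (le_trans (concave_chord_le a0 b0 l01))//.
by move: rho_s_le; rewrite -/s; move: (rho s) => r; lra.
Qed.

Lemma concave_deriv_noninc (a b : R) : 0 <= a -> a <= b -> rho' b <= rho' a.
Proof.
move=> a0; rewrite le_eqVlt => /predU1P[->//|ab].
have b0 := le_trans a0 (ltW ab).
have tangent_a := concave_tangent a0 b0; have tangent_b := concave_tangent b0 a0.
by rewrite -subr_gt0 in ab; rewrite -(ler_pM2r ab); lra.
Qed.

Lemma concave_lipschitz (a b : R) :
  (forall t, 0 <= t -> 0 <= rho' t) -> 0 <= a -> 0 <= b ->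
  `|rho a - rho b| <= rho' 0 * `|a - b|.
Proof.
move=> rho'_ge0; wlog ab : a b / a <= b.
  move=> le_case a0 b0; have [ab|/ltW ba] := leP a b; first exact: le_case.
  by rewrite distrC (distrC a) le_case.
move=> a0 b0; have ba : 0 <= b - a by rewrite subr_ge0.
have tangent_a := concave_tangent a0 b0; have tangent_b := concave_tangent b0 a0.
have rho'b : 0 <= rho' b * (b - a) by rewrite mulr_ge0// rho'_ge0.
have rho'a : rho' a * (b - a) <= rho' 0 * (b - a).
  by rewrite ler_wpM2r// concave_deriv_noninc.
by rewrite distrC ger0_norm ?(distrC a) ?(ger0_norm ba); lra.
Qed.

End ConcaveFunction.

Section FirstOrder.
Variables (R : realType) (n1 n2 n3 : nat).
Local Notation T := (tensor R n1 n2 n3).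
Implicit Types (u e : T -> R) (v w : nat -> T) (X : T).

Definition tlipschitz u := exists2 C : R, 0 <= C &
  forall X Y, `|u X - u Y| <= C * tnorm (tsub X Y).

Definition tlittleo X e := forall eps : R, 0 < eps -> exists2 delta : R, 0 < delta &
  forall Y, tnorm (tsub Y X) < delta -> `|e Y| <= eps * tnorm (tsub Y X).

Lemma tlipschitzD u1 u2 : tlipschitz u1 -> tlipschitz u2 ->
  tlipschitz (fun X => u1 X + u2 X).
Proof.
move=> [C1 C1_ge0 u1_lip] [C2 C2_ge0 u2_lip]; exists (C1 + C2) => [|X Y].
  exact: addr_ge0.
by rewrite opprD addrACA mulrDl (le_trans (ler_normD _ _))// lerD.
Qed.

Lemma tlipschitzZ (a : R) u : tlipschitz u -> tlipschitz (fun X => a * u X).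
Proof.
move=> [C C_ge0 u_lip]; exists (`|a| * C) => [|X Y]; first exact: mulr_ge0.
by rewrite -mulrBr normrM -mulrA ler_wpM2l.
Qed.

Lemma tlipschitz_cvg u v X : tlipschitz u -> tcvg v X ->
  u (v t) @[t --> \oo] --> u X.
Proof. by move=> [C _ u_lip] vX; apply: cvgr_dist_le vX => t; exact: u_lip. Qed.

Lemma tlittleoD X e1 e2 : tlittleo X e1 -> tlittleo X e2 ->
  tlittleo X (fun Y => e1 Y + e2 Y).
Proof.
move=> o1 o2 eps eps0; have eps2 : 0 < eps / 2 by rewrite divr_gt0.
have [d1 d1_gt0 e1_le] := o1 _ eps2; have [d2 d2_gt0 e2_le] := o2 _ eps2.
exists (Num.min d1 d2) => [|Y]; first by rewrite lt_min d1_gt0.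
rewrite lt_min => /andP[/e1_le {}e1_le /e2_le {}e2_le].
by rewrite (le_trans (ler_normD _ _))// [eps]splitr mulrDl lerD.
Qed.

Lemma tlittleoZ (a : R) X e : tlittleo X e -> tlittleo X (fun Y => a * e Y).
Proof.
move=> oe eps eps0; have a1 : 0 < `|a| + 1 by rewrite ltr_wpDl.
have [d d0 e_le] := oe _ (divr_gt0 eps0 a1); exists d => // Y /e_le {}e_le.
rewrite normrM (@le_trans _ _ ((`|a| + 1) * `|e Y|))//.
  by rewrite ler_wpM2r// lerDl.
by rewrite mulrC -ler_pdivlMr// mulrAC.
Qed.

Lemma tlittleo0 X : tlittleo X (fun=> 0).
Proof.
move=> eps eps0; exists 1 => // Y _.
by rewrite normr0 mulr_ge0 ?tnorm_ge0// ltW.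
Qed.

Lemma tlittleo_sqr_tnorm X : tlittleo X (fun Y => tnorm (tsub Y X) ^+ 2).
Proof.
move=> eps eps0; exists eps => // Y /ltW Y_near.
by rewrite ger0_norm ?sqr_ge0// expr2 ler_wpM2r ?tnorm_ge0.
Qed.

Lemma tlittleo_cvg0 X e v : tlittleo X e -> tcvg v X ->
  e (v t) @[t --> \oo] --> (0 : R).
Proof.
move=> oe vX; have [d d0 e_le] := oe 1 ltr01; apply/norm_cvg0P.
apply: (@squeeze_cvgr _ _ _ _ (fun=> 0) (fun t => tnorm (tsub (v t) X))) => //.
  near=> t; rewrite normr_ge0 -[X in _ <= X]mul1r e_le//.
  rewrite -[tnorm _]ger0_norm ?tnorm_ge0//; near: t.
  exact: cvgr0_norm_lt d0.
exact: cvg_cst.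
Unshelve. all: by end_near. Qed.

Lemma frechet_limiting_subdiff u X V :
  frechet_subdiff u X V -> limiting_subdiff u X V.
Proof.
move=> uV; exists (fun=> X), (fun=> V).
by split=> //; [exact: tcvg_cst|exact: cvg_cst|exact: tcvg_cst].
Qed.

Section Surrogates.
Implicit Type h : T -> T -> R.

Record first_order_surrogate u h : Prop := FirstOrderSurrogate {
  surrogate_lipschitz : tlipschitz u;
  surrogate_majorizes : forall V W, u W - u V <= h V W - h V V;
  surrogate_tangent : forall V,
    tlittleo V (fun W => u W - u V - (h V W - h V V));
  surrogate_cvg : forall v w V W, tcvg v V -> tcvg w W ->
    h (v t) (w t) @[t --> \oo] --> h V W }.

Lemma eq_surrogate u u' h h' : u =1 u' -> h =2 h' ->
  first_order_surrogate u h -> first_order_surrogate u' h'.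
Proof. by move=> /funext-> hh'; have -> : h = h' by do 2!apply/funext => ?. Qed.

Lemma surrogate_self u : tlipschitz u -> first_order_surrogate u (fun=> u).
Proof.
move=> u_lip; split=> // [V|v w V W _ wW]; last exact: tlipschitz_cvg wW.
by under eq_fun do rewrite subrr; exact: tlittleo0.
Qed.

Lemma surrogateD u1 u2 h1 h2 :
  first_order_surrogate u1 h1 -> first_order_surrogate u2 h2 ->
  first_order_surrogate (fun X => u1 X + u2 X) (fun V W => h1 V W + h2 V W).
Proof.
move=> [u1_lip u1_le u1_o h1_cvg] [u2_lip u2_le u2_o h2_cvg]; split.
- exact: tlipschitzD.
- by move=> V W; have := u1_le V W; have := u2_le V W; lra.
- move=> V; have := tlittleoD (u1_o V) (u2_o V).
  by congr tlittleo; apply/funext => W; ring.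
- by move=> v w V W vV wW; apply: cvgD; [exact: h1_cvg|exact: h2_cvg].
Qed.

Lemma surrogateZ (a : R) u h : 0 <= a -> first_order_surrogate u h ->
  first_order_surrogate (fun X => a * u X) (fun V W => a * h V W).
Proof.
move=> a_ge0 [u_lip u_le u_o h_cvg]; split.
- exact: tlipschitzZ.
- by move=> V W; rewrite -!mulrBr ler_wpM2l.
- move=> V; have := tlittleoZ a (u_o V).
  by congr tlittleo; apply/funext => W; ring.
- by move=> v w V W vV wW; apply: cvgM; [exact: cvg_cst|exact: h_cvg].
Qed.

Lemma surrogate_sum (I : Type) (s : seq I) (u : I -> T -> R) (h : I -> T -> T -> R) :
  (forall i, first_order_surrogate (u i) (h i)) ->
  first_order_surrogate (fun X => \sum_(i <- s) u i X)
                        (fun V W => \sum_(i <- s) h i V W).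
Proof.
move=> uh; elim: s => [|i s IH].
  apply: (@eq_surrogate (fun=> 0) _ (fun _ _ => 0)) => [X|V W|].
  - by rewrite big_nil.
  - by rewrite big_nil.
  - by apply: surrogate_self; exists 0 => // X Y; rewrite subrr normr0 mul0r.
by apply: (eq_surrogate _ _ (surrogateD (uh i) IH)) => [X|V W]; rewrite big_cons.
Qed.

Section ConcaveComposition.
Variables (rho rho' : R -> R) (Lg : R).
Hypothesis rho_deriv : deriv_on_nonneg rho rho'.
Hypothesis rho_concave : concave_on_nonneg rho.
Hypothesis rho'_lip :
  forall x y, 0 <= x -> 0 <= y -> `|rho' x - rho' y| <= Lg * `|x - y|.
Hypothesis rho'_ge0 : forall t, 0 <= t -> 0 <= rho' t.
Variable u : T -> R.
Hypothesis u_ge0 : forall X, 0 <= u X.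

Lemma tlipschitz_comp_concave : tlipschitz u -> tlipschitz (rho \o u).
Proof.
move=> [C C_ge0 u_lip]; have rho'0_ge0 := rho'_ge0 (lexx 0).
exists (rho' 0 * C) => [|X Y]; first exact: mulr_ge0.
have := concave_lipschitz rho_deriv rho_concave rho'_ge0 (u_ge0 X) (u_ge0 Y).
by move=> /le_trans; apply; rewrite -mulrA ler_wpM2l.
Qed.

Lemma tlittleo_comp_deriv X : tlipschitz u ->
  tlittleo X (fun Y => rho (u Y) - rho (u X) - rho' (u X) * (u Y - u X)).
Proof.
move=> [C C_ge0 u_lip] eps eps0; have C1_gt0 : 0 < C + 1 by rewrite ltr_wpDl.
have [d d0 rho_near] := rho_deriv (u_ge0 X) (divr_gt0 eps0 C1_gt0).
exists (d / (C + 1)) => [|Y]; first by rewrite divr_gt0.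
rewrite ltr_pdivlMr// => Y_near.
have uYX : `|u Y - u X| <= (C + 1) * tnorm (tsub Y X).
  by apply: le_trans (u_lip Y X) _; rewrite ler_wpM2r ?tnorm_ge0// lerDl.
apply: le_trans (rho_near _ (u_ge0 Y) _) _.
  by apply: le_lt_trans uYX _; rewrite mulrC.
by rewrite mulrAC ler_pdivrMr// -mulrA ler_wpM2l ?(ltW eps0)// mulrC.
Qed.

Lemma deriv_comp_cvg v X : tlipschitz u -> tcvg v X ->
  rho' (u (v t)) @[t --> \oo] --> rho' (u X).
Proof.
move=> u_lip vX; apply: (@cvgr_dist_le _ _ (fun t => `|u (v t) - u X|) _ Lg).
  by move=> t; exact: rho'_lip.
exact/norm_cvg0P/subr_cvg0/tlipschitz_cvg.
Qed.

Lemma surrogate_comp_concave h : first_order_surrogate u h ->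
  first_order_surrogate (rho \o u) (fun V W => rho' (u V) * h V W).
Proof.
move=> [u_lip u_le u_o h_cvg]; split.
- exact: tlipschitz_comp_concave.
- move=> V W; apply: le_trans (concave_tangent rho_deriv rho_concave _ _) _ => //.
  by rewrite -mulrBr ler_wpM2l// rho'_ge0.
- move=> V.
  have := tlittleoD (tlittleo_comp_deriv V u_lip) (tlittleoZ (rho' (u V)) (u_o V)).
  by congr tlittleo; apply/funext => W /=; ring.
- by move=> v w V W vV wW; apply: cvgM; [exact: deriv_comp_cvg|exact: h_cvg].
Qed.

End ConcaveComposition.
End Surrogates.
End FirstOrder.

Section SpectralPenalty.
Variables (R : realType) (n1 n2 n3 : nat).
Local Notation T := (tensor R n1 n2 n3).
Variables (rho rho' : R -> R) (Lg : R).
Hypothesis rho_nonneg : forall t, 0 <= t -> 0 <= rho t.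
Hypothesis rho_deriv : deriv_on_nonneg rho rho'.
Hypothesis rho_concave : concave_on_nonneg rho.
Hypothesis rho'_lip :
  forall x y, 0 <= x -> 0 <= y -> `|rho' x - rho' y| <= Lg * `|x - y|.
Hypothesis rho'_ge0 : forall t, 0 <= t -> 0 <= rho' t.

Definition slice_penalty (k : 'I_n3) (X : T) : R :=
  \sum_(i < minn n1 n2) rho (rho (tsigma X k i)).

Definition spectral_penalty (X : T) : R := \sum_(k < n3) rho (slice_penalty k X).

Definition reweighted_norm (V W : T) : R :=
  wnorm rho (alphaw rho rho' V) (betaw rho rho' V) W.

Lemma tlipschitz_tsigma k (i : 'I_(minn n1 n2)) :
  tlipschitz (fun X : T => tsigma X k i).
Proof. by exists (n1 * n2 * n3)%:R => // X Y; exact: tsigma_lipschitz. Qed.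

Lemma slice_penalty_surrogate k : first_order_surrogate (slice_penalty k)
  (fun V W => \sum_(i < minn n1 n2) betaw rho rho' V k i * rho (tsigma W k i)).
Proof.
apply: surrogate_sum => i.
apply: (surrogate_comp_concave rho_deriv rho_concave rho'_lip rho'_ge0
  (u := fun X => rho (tsigma X k i))) => [X|].
  exact/rho_nonneg/tsigma_ge0.
apply/surrogate_self/(tlipschitz_comp_concave rho_deriv rho_concave rho'_ge0).
  by move=> X; exact: tsigma_ge0.
exact: tlipschitz_tsigma.
Qed.

Lemma spectral_penalty_surrogate :
  first_order_surrogate spectral_penalty reweighted_norm.
Proof.
apply: (eq_surrogate (fun=> erefl) (h := fun V W =>
    \sum_(k < n3) alphaw rho rho' V k *
    \sum_(i < minn n1 n2) betaw rho rho' V k i * rho (tsigma W k i))) => [V W|].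
  apply: eq_bigr => k _; rewrite mulr_sumr.
  by apply: eq_bigr => i _; rewrite mulrA.
apply: surrogate_sum => k.
apply: (surrogate_comp_concave rho_deriv rho_concave rho'_lip rho'_ge0) => [X|].
  by apply: sumr_ge0 => i _; exact/rho_nonneg/rho_nonneg/tsigma_ge0.
exact: slice_penalty_surrogate.
Qed.

End SpectralPenalty.

Section LipschitzGradient.
Variables (R : realType) (n1 n2 n3 : nat).
Local Notation T := (tensor R n1 n2 n3).
Variables (f : T -> R) (g : T -> T).

Record lipschitz_gradient (L : R) : Prop := LipschitzGradient {
  gradient_of : is_gradient f g;
  gradient_lipschitz : forall X Y,
    tnorm (tsub (g X) (g Y)) <= L * tnorm (tsub X Y) }.

Lemma gradient_tlittleo X : is_gradient f g ->
  tlittleo X (fun Y => f Y - f X - tdot (g X) (tsub Y X)).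
Proof. exact. Qed.

Lemma gradient_continuous (v : nat -> T) X : is_gradient f g -> tcvg v X ->
  f (v t) @[t --> \oo] --> f X.
Proof.
move=> fg vX; apply/subr_cvg0.
have gradient_term : tdot (g X) (tsub (v t) X) @[t --> \oo] --> (0 : R).
  rewrite -(subrr (tdot (g X) X)) -tdotBr.
  by apply: tdot_cvg; [exact: tcvg_cst|apply: tcvgB => //; exact: tcvg_cst].
rewrite -(addr0 0).
have -> : (fun t => f (v t) - f X) = (fun t =>
    f (v t) - f X - tdot (g X) (tsub (v t) X) + tdot (g X) (tsub (v t) X)).
  by apply/funext => t; rewrite subrK.
by apply: cvgD => //; exact: tlittleo_cvg0 (gradient_tlittleo X fg) vX.
Qed.

Lemma lipschitz_gradient_cvg (L : R) (v : nat -> T) X :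
  lipschitz_gradient L -> tcvg v X -> tcvg (fun t => g (v t)) (g X).
Proof.
move=> fg vX; apply: (@cvgr_dist_le _ _ (fun t => tnorm (tsub (v t) X)) _ L) => // t.
by rewrite subr0 ger0_norm ?tnorm_ge0// (gradient_lipschitz fg).
Qed.

Lemma is_derive_line (X D : T) (s : R) : is_gradient f g ->
  is_derive s 1 (fun r : R => f (tadd X (tscale r D)))
    (tdot (g (tadd X (tscale s D))) D).
Proof.
move=> fg; set df := tdot _ _; set phi := fun r => _.
have phi_cvg : h^-1 *: ((phi \o shift s) (h *: 1) - phi s) @[h --> 0^'] --> df.
  apply/cvgrPdist_le => e e0.
  have D1_gt0 : 0 < tnorm D + 1 by rewrite ltr_wpDl ?tnorm_ge0.
  have [d d0 f_near] := fg (tadd X (tscale s D)) _ (divr_gt0 e0 D1_gt0).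
  near=> h.
  have h_neq0 : h != 0 by near: h; exact: nbhs_dnbhs_neq.
  have h_gt0 : 0 < `|h| by rewrite normr_gt0.
  have h_lt : `|h| < d / (tnorm D + 1).
    by near: h; apply: dnbhs0_lt; rewrite divr_gt0.
  have stepE : tsub (tadd X (tscale (h + s) D)) (tadd X (tscale s D)) = tscale h D.
    by tensor_ring.
  have step_lt : `|h| * tnorm D < d.
    rewrite (@le_lt_trans _ _ (`|h| * (tnorm D + 1))) -?ltr_pdivlMr//.
    by rewrite ler_wpM2l// lerDl.
  have := f_near (tadd X (tscale (h + s) D)); rewrite stepE tnormZ tdotZr -/df.
  move=> /(_ step_lt) phi_near.
  rewrite /= scaler1 -/(phi (h + s)) -(ler_pM2l h_gt0) -normrM mulrBr.
  rewrite [h * (h^-1 *: _)](mulrA h) divff// mul1r distrC.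
  apply: le_trans phi_near _.
  rewrite mulrCA ler_wpM2l// mulrAC ler_pdivrMr// ler_wpM2l ?ltW//.
  by rewrite ltrDl.
by apply: DeriveDef; [apply/cvg_ex; exists df|exact: (cvg_lim _ phi_cvg)].
Unshelve. all: by end_near. Qed.

Lemma lipschitz_gradient_upper (L : R) (X Y : T) : lipschitz_gradient L ->
  f Y - f X - tdot (g X) (tsub Y X) <= L / 2 * tnorm (tsub Y X) ^+ 2.
Proof.
move=> [fg g_lip]; set D := tsub Y X; pose c := tdot (g X) D; pose q := tnorm D ^+ 2.
pose phi (s : R) := f (tadd X (tscale s D)) - s * c - s ^+ 2 * (L / 2 * q).
pose dphi (s : R) := tdot (g (tadd X (tscale s D))) D - c - s * (L * q).
have phi_derive (s : R) : is_derive s 1 phi (dphi s).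
  have line_derive := is_derive_line X D s fg.
  by rewrite /phi; apply: is_derive_eq; rewrite /dphi /GRing.scale /=; field.
have dphi_le0 (s : R) : 0 <= s -> dphi s <= 0.
  move=> s0; rewrite /dphi /c -tdotBl subr_le0; apply: le_trans (tdot_le _ _) _.
  have -> : s * (L * q) = L * (s * tnorm D) * tnorm D by rewrite /q; ring.
  rewrite ler_wpM2r ?tnorm_ge0// (le_trans (g_lip _ _))//.
  have -> : tsub (tadd X (tscale s D)) X = tscale s D by tensor_ring.
  by rewrite tnormZ ger0_norm.
have phi_cont : {within `[0, 1], continuous phi}.
  by apply: derivable_within_continuous => s _; exact: ex_derive.
have [s /itvP s01] := MVT_segment ler01 (fun s _ => phi_derive s) phi_cont.
rewrite subr0 mulr1 => phi10.
have : phi 1 - phi 0 <= 0 by rewrite phi10 dphi_le0// s01.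
have -> : phi 1 = f Y - c - L / 2 * q.
  rewrite /phi (_ : tadd X (tscale 1 D) = Y); last by tensor_ring.
  by rewrite expr1n !mul1r.
have -> : phi 0 = f X.
  rewrite /phi (_ : tadd X (tscale 0 D) = X); last by tensor_ring.
  by rewrite expr0n !mul0r !subr0.
by rewrite -/c -/q subr_le0 lerBlDr -lerBlDl addrAC.
Qed.

End LipschitzGradient.

Section DescentLemma.
Variables (R : realType) (n1 n2 n3 : nat).
Local Notation T := (tensor R n1 n2 n3).
Variables (f : T -> R) (g : T -> T) (L : R).

Lemma lipschitz_gradientN : lipschitz_gradient f g L ->
  lipschitz_gradient (fun X => - f X) (fun X => tscale (-1) (g X)) L.
Proof.
move=> [fg g_lip]; split=> [X|X Y].
  have := tlittleoZ (-1) (gradient_tlittleo X fg).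
  by congr tlittleo; apply/funext => Y; rewrite tdotZl; ring.
rewrite (_ : tsub _ _ = tscale (-1) (tsub (g X) (g Y))); last by tensor_ring.
by rewrite tnormZ normrN1 mul1r g_lip.
Qed.

Lemma descent_lemma (X Y : T) : lipschitz_gradient f g L ->
  `|f Y - f X - tdot (g X) (tsub Y X)| <= L / 2 * tnorm (tsub Y X) ^+ 2.
Proof.
move=> fg; rewrite ler_norml lipschitz_gradient_upper// andbT.
have := lipschitz_gradient_upper X Y (lipschitz_gradientN fg).
by rewrite tdotZl; move: (tdot _ _) (_ * _ ^+ 2) => *; lra.
Qed.

End DescentLemma.

Section InertialMajorizationMinimization.
Variables (R : realType) (n1 n2 n3 : nat).
Local Notation T := (tensor R n1 n2 n3).
Variables (P : T -> R) (h : T -> T -> R) (f : T -> R) (g : T -> T) (L : R).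
Hypothesis P_surrogate : first_order_surrogate P h.
Hypothesis f_smooth : lipschitz_gradient f g L.

Definition objective (W : T) : R := P W + f W.

Definition prox_model (V Y Z : T) (m : R) (W : T) : R :=
  h V W + tdot (tsub W Y) (g Z) + m / 2 * tnorm (tsub W Y) ^+ 2.

Lemma objective_continuous (v : nat -> T) X : tcvg v X ->
  objective (v t) @[t --> \oo] --> objective X.
Proof.
move=> vX; apply: cvgD; last exact: gradient_continuous (gradient_of f_smooth) vX.
exact: tlipschitz_cvg (surrogate_lipschitz P_surrogate) vX.
Qed.

Lemma prox_model_cvg (v y z w : nat -> T) (m : nat -> R) V Y Z M W :
  tcvg v V -> tcvg y Y -> tcvg z Z -> m t @[t --> \oo] --> M -> tcvg w W ->
  prox_model (v t) (y t) (z t) (m t) (w t) @[t --> \oo] --> prox_model V Y Z M W.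
Proof.
move=> vV yY zZ mM wW; have wyWY := tcvgB wW yY.
apply: cvgD; first apply: cvgD.
- exact: (surrogate_cvg P_surrogate).
- by apply: tdot_cvg => //; exact: lipschitz_gradient_cvg f_smooth zZ.
- apply: cvgM; first by apply: cvgM; [exact: mM|exact: cvg_cst].
  by under eq_fun do rewrite sqr_tnorm; rewrite sqr_tnorm; exact: tdot_cvg.
Qed.

(* To first order at V the objective is its prox model without the quadratic term. *)
Lemma prox_minimal_stationary (V : T) (m : R) :
  (forall W, prox_model V V V m V <= prox_model V V V m W) ->
  frechet_subdiff objective V (@tzero R n1 n2 n3).
Proof.
move=> V_min e e0.
have remainder := tlittleoD (tlittleoD (surrogate_tangent P_surrogate V)
  (gradient_tlittleo V (gradient_of f_smooth)))
  (tlittleoZ (- (m / 2)) (tlittleo_sqr_tnorm V)).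
have [d d0 remainder_le] := remainder e e0.
exists d => // W /remainder_le; rewrite ler_norml => /andP[remainder_ge _].
apply: le_trans remainder_ge _; have := V_min W.
rewrite /prox_model /objective tdotBl subrr tnorm_subxx tdot0l (tdotC (g V)).
move: (P _) (P _) (h _ _) (h _ _) (tdot _ _) (f _) (f _) (tnorm _) => *.
by lra.
Qed.

Section ProxStep.
Variables (Xm X0 X1 : T) (a c m : R).
Local Notation D := (tsub X1 X0).
Local Notation S := (tsub X0 Xm).
Local Notation Y := (tadd X0 (tscale a S)).
Local Notation Z := (tadd X0 (tscale c S)).
Hypothesis X1_le : prox_model X0 Y Z m X1 <= prox_model X0 Y Z m X0.

(* The smoothness of f is used at the extrapolated point, forwards to X1 and
   backwards to X0. *)
Lemma prox_step_expansion : objective X1 - objective X0 <= (L - m) / 2 * tnorm D ^+ 2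
  + (m * a - L * c) * tdot D S + L * c ^+ 2 * tnorm S ^+ 2.
Proof.
have := X1_le.
have /ler_normlP[_] := descent_lemma Z X1 f_smooth.
have /ler_normlP[] := descent_lemma Z X0 f_smooth => + _.
have := surrogate_majorizes P_surrogate X0 X1; rewrite /prox_model /objective.
have -> : tsub X1 Y = tsub D (tscale a S) by tensor_ring.
have -> : tsub X0 Y = tscale (- a) S by tensor_ring.
have -> : tsub X1 Z = tsub D (tscale c S) by tensor_ring.
have -> : tsub X0 Z = tscale (- c) S by tensor_ring.
move: D S (g Z) => d s gZ.
rewrite !sqr_tnorm !(tdotBl, tdotBr, tdotZl, tdotZr).
rewrite (tdotC s d) (tdotC gZ d) (tdotC gZ s).
move: (P _) (P _) (h _ _) (h _ _) (f Z) (f X0) (f X1).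
move: (tdot d s) (tdot d d) (tdot s s) (tdot d _) (tdot s _) => *.
by lra.
Qed.

Lemma prox_step_decrease : 0 <= L -> 0 <= c <= 1 / 2 -> c * L <= m * a ->
  objective X1 + (m * (1 - a) - (1 - c) * L) / 2 * tnorm D ^+ 2
  <= objective X0 + m * a / 2 * tnorm S ^+ 2.
Proof.
move=> L0 /andP[c0 c_le] cL_le; have := prox_step_expansion.
rewrite !sqr_tnorm; move: (tdot_young D S) (tdot_ge0 S).
move: (objective _) (objective _) (tdot D D) (tdot D S) (tdot S S) => F1 F0 dd ds ss.
move=> young ss0 expansion.
have cross_le : (m * a - L * c) * ds <= (m * a - L * c) / 2 * (dd + ss).
  by rewrite mulrAC -mulrA ler_wpM2l//; lra.
have square_le : L * c ^+ 2 * ss <= L * c / 2 * ss.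
  by rewrite ler_wpM2r// -mulrA ler_wpM2l//; nra.
by lra.
Qed.

End ProxStep.

Record admissible_steps (eps : R) (theta1 theta2 mu : nat -> R) : Prop :=
  AdmissibleSteps {
    smoothness_gt0 : 0 < L;
    margin_gt0 : 0 < eps;
    theta1_bounds : forall t, 0 <= theta1 t < (1 - eps) / 2;
    theta2_bounds : forall t, 0 <= theta2 t <= 1 / 2;
    mu_noninc : forall t, mu t.+1 <= mu t;
    mu_theta1_ge : forall t, theta2 t * L <= mu t * theta1 t;
    mu_ge : forall t,
      (1 - theta2 t) * L / (1 - theta1 t - theta1 t.+1 - eps) <= mu t }.

Section Iterates.
Variables (eps : R) (theta1 theta2 mu : nat -> R) (X : nat -> T).
Hypothesis steps : admissible_steps eps theta1 theta2 mu.
Hypothesis X_min : forall t W,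
  prox_model (X t) (extrap X theta1 t) (extrap X theta2 t) (mu t) (X t.+1) <=
  prox_model (X t) (extrap X theta1 t) (extrap X theta2 t) (mu t) W.

Definition increment t : T := tsub (X t) (Xprev X t).

Definition lyapunov t : R :=
  objective (X t) + mu t * theta1 t / 2 * tnorm (increment t) ^+ 2.

Lemma mu_margin_ge t :
  (1 - theta2 t) * L <= mu t * (1 - theta1 t - theta1 t.+1 - eps).
Proof.
have /andP[_ theta1_lt] := theta1_bounds steps t.
have /andP[_ theta1S_lt] := theta1_bounds steps t.+1.
by rewrite -ler_pdivrMr ?(mu_ge steps)//; lra.
Qed.

Lemma mu_ge_half t : L / 2 <= mu t.
Proof.
have := mu_margin_ge t; have L_gt0 := smoothness_gt0 steps.
have eps_gt0 := margin_gt0 steps; have /andP[_ theta2_le] := theta2_bounds steps t.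
have /andP[theta1_ge0 theta1_lt] := theta1_bounds steps t.
have /andP[theta1S_ge0 theta1S_lt] := theta1_bounds steps t.+1.
have L_le : L / 2 <= (1 - theta2 t) * L by nra.
move=> /(le_trans L_le) margin_ge.
have mu_t_ge0 : 0 <= mu t by rewrite leNgt; apply/negP => mu_t_lt0; nra.
by nra.
Qed.

Lemma mu_ge0 t : 0 <= mu t.
Proof.
by rewrite (le_trans _ (mu_ge_half t))// divr_ge0// ltW// (smoothness_gt0 steps).
Qed.

Lemma mu_cvg : cvgn mu.
Proof.
apply: nonincreasing_is_cvgn; first exact/nonincreasing_seqP/(mu_noninc steps).
by exists 0 => _ [t _ <-]; exact: mu_ge0.
Qed.

Lemma lyapunov_decrease t :
  lyapunov t.+1 + L * eps / 4 * tnorm (increment t.+1) ^+ 2 <= lyapunov t.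
Proof.
have /andP[theta1S_ge0 _] := theta1_bounds steps t.+1.
have L_ge0 := ltW (smoothness_gt0 steps).
apply: le_trans (prox_step_decrease (X_min t (X t)) L_ge0 (theta2_bounds steps t)
  (mu_theta1_ge steps t)).
rewrite /lyapunov -addrA lerD2l -mulrDl ler_wpM2r ?sqr_ge0//.
have inertia_le : mu t.+1 * theta1 t.+1 <= mu t * theta1 t.+1.
  by rewrite ler_wpM2r// (mu_noninc steps).
have margin_le : L / 2 * eps <= mu t * eps.
  by rewrite ler_wpM2r ?mu_ge_half// ltW// (margin_gt0 steps).
by have := mu_margin_ge t; lra.
Qed.

Lemma inertia_bounds t : 0 <= mu t * theta1 t / 2 <= mu 0%N.
Proof.
have /andP[theta1_ge0 theta1_lt] := theta1_bounds steps t.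
have mu_t_ge0 := mu_ge0 t; have eps_gt0 := margin_gt0 steps.
have mu_le : mu t <= mu 0%N.
  by have /nonincreasing_seqP := mu_noninc steps; apply.
by apply/andP; split; nra.
Qed.

Lemma objective_le_lyapunov t : objective (X t) <= lyapunov t.
Proof.
by have /andP[? _] := inertia_bounds t; rewrite lerDl mulr_ge0// sqr_ge0.
Qed.

Lemma lyapunov_le_initial t : lyapunov t <= lyapunov 0.
Proof.
suff /nonincreasing_seqP : forall t, lyapunov t.+1 <= lyapunov t by apply.
move=> s; apply: le_trans (lyapunov_decrease s); rewrite lerDl mulr_ge0 ?sqr_ge0//.
by rewrite divr_ge0// mulr_ge0// ltW ?(smoothness_gt0 steps) ?(margin_gt0 steps).
Qed.

Lemma iterates_bounded :
  (forall M : R, exists K : R, forall W, K < tnorm W -> M < objective W) ->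
  exists B : R, forall t, tnorm (X t) <= B.
Proof.
move=> /(_ (lyapunov 0))[K objective_large]; exists K => t.
rewrite leNgt; apply/negP => /objective_large; apply/negP; rewrite -leNgt.
exact: le_trans (objective_le_lyapunov t) (lyapunov_le_initial t).
Qed.

Section BoundedBelow.
Hypothesis objective_bounded_below : exists M : R, forall W, M <= objective W.

Lemma lyapunov_increment_cvg : cvgn lyapunov /\ tnorm (increment t) @[t --> \oo] --> 0.
Proof.
have [M objective_ge] := objective_bounded_below.
have rate_gt0 : 0 < L * eps / 4.
  by rewrite divr_gt0// mulr_gt0 ?(smoothness_gt0 steps) ?(margin_gt0 steps).
have [lyapunov_cvg increment_sqr_cvg0] := sufficient_decrease_cvg rate_gt0
  (fun t => sqr_ge0 (tnorm (increment t.+1)))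
  (fun t => le_trans (objective_ge _) (objective_le_lyapunov t)) lyapunov_decrease.
split=> //; rewrite -(cvg_shiftS (fun t => tnorm (increment t))).
exact: sqr_cvg0 increment_sqr_cvg0.
Qed.

Lemma objective_iterates_cvg : cvgn (fun t => objective (X t)).
Proof.
have [lyapunov_cvg increment_cvg0] := lyapunov_increment_cvg.
apply/cvg_ex; exists (limn lyapunov - 0).
have -> : (fun t => objective (X t)) =
    (fun t => lyapunov t - mu t * theta1 t / 2 * tnorm (increment t) ^+ 2).
  by apply/funext => t; rewrite addrK.
apply: cvgB => //.
apply: (@cvgr_dist_le _ _ (fun t => tnorm (increment t) ^+ 2) _ (mu 0%N)) => [t|].
  have /andP[inertia_ge0 inertia_le] := inertia_bounds t.
  rewrite subr0 ger0_norm; last by rewrite mulr_ge0 ?sqr_ge0.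
  by rewrite ler_wpM2r ?sqr_ge0.
have -> : (0 : R) = 0 * 0 by rewrite mulr0.
exact: cvgM.
Qed.

Section AccumulationPoint.
Variables (Xs : T) (phi : nat -> nat).
Hypothesis phi_inc : {homo phi : m n / (m < n)%N}.
Hypothesis phi_cvg : tcvg (fun l => X (phi l)) Xs.

Lemma next_iterate_cvg : tcvg (fun l => X (phi l).+1) Xs.
Proof.
have [_ increment_cvg0] := lyapunov_increment_cvg.
apply: (tcvg_dist0 phi_cvg).
apply: (cvgn_subseq (u := fun t => tnorm (increment t.+1)) phi_inc).
by rewrite (cvg_shiftS (fun t => tnorm (increment t))).
Qed.

Lemma extrap_cvg (theta : nat -> R) : (forall t, 0 <= theta t <= 1) ->
  tcvg (fun l => extrap X theta (phi l)) Xs.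
Proof.
have [_ increment_cvg0] := lyapunov_increment_cvg.
move=> theta01; apply: (tcvg_dist0 phi_cvg).
apply: (@cvgr_dist_le _ _ (fun l => tnorm (increment (phi l))) _ 1) => [l|].
  have -> : tsub (extrap X theta (phi l)) (X (phi l)) =
      tscale (theta (phi l)) (increment (phi l)) by tensor_ring.
  have /andP[theta_ge0 theta_le1] := theta01 (phi l).
  rewrite subr0 ger0_norm ?tnorm_ge0// tnormZ.
  by rewrite ler_wpM2r ?tnorm_ge0 ?ger0_norm.
exact: (cvgn_subseq (u := fun t => tnorm (increment t)) phi_inc).
Qed.

Lemma accumulation_prox_minimal W :
  prox_model Xs Xs Xs (limn mu) Xs <= prox_model Xs Xs Xs (limn mu) W.
Proof.
have eps_gt0 := margin_gt0 steps.
have Y_cvg : tcvg (fun l => extrap X theta1 (phi l)) Xs.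
  by apply: extrap_cvg => t; have /andP[? ?] := theta1_bounds steps t; lra.
have Z_cvg : tcvg (fun l => extrap X theta2 (phi l)) Xs.
  by apply: extrap_cvg => t; have /andP[? ?] := theta2_bounds steps t; lra.
have mu_phi_cvg := cvgn_subseq phi_inc mu_cvg.
have minimum_cvg := prox_model_cvg phi_cvg Y_cvg Z_cvg mu_phi_cvg next_iterate_cvg.
have competitor_cvg := prox_model_cvg phi_cvg Y_cvg Z_cvg mu_phi_cvg (tcvg_cst W).
by apply: (ler_cvg_to minimum_cvg competitor_cvg); near=> l; exact: X_min.
Unshelve. all: by end_near. Qed.

Lemma accumulation_stationary : limiting_subdiff objective Xs (@tzero R n1 n2 n3).
Proof.
exact/frechet_limiting_subdiff/prox_minimal_stationary/accumulation_prox_minimal.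
Qed.

Lemma next_objective_cvg :
  objective (X (phi l).+1) @[l --> \oo] --> objective Xs.
Proof. exact/objective_continuous/next_iterate_cvg. Qed.

End AccumulationPoint.
End BoundedBelow.
End Iterates.
End InertialMajorizationMinimization.

Theorem theorem2 (R : realType) (n1 n2 n3 : nat)
  (hn1 : (0 < n1)%N) (hn2 : (0 < n2)%N) (hn3 : (0 < n3)%N)
  (lam : R) (hlam : 0 < lam)
  (* Assumption A1 *)
  (rho rho' : R -> R) (Lg : R)
  (rho_nonneg : forall t, 0 <= t -> 0 <= rho t)
  (rho_deriv : deriv_on_nonneg rho rho')
  (rho_concave : concave_on_nonneg rho)
  (rho'_lip : forall x y, 0 <= x -> 0 <= y -> `|rho' x - rho' y| <= Lg * `|x - y|)
  (rho'_pos : forall t, 0 <= t -> 0 < rho' t)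
  (* Assumption A2 *)
  (f : tensor R n1 n2 n3 -> R) (gradf : tensor R n1 n2 n3 -> tensor R n1 n2 n3)
  (Lf : R) (hLf : 0 < Lf)
  (f_nonneg : forall X, 0 <= f X)
  (f_grad : is_gradient f gradf)
  (gradf_lip : forall X Y, tnorm (tsub (gradf X) (gradf Y)) <= Lf * tnorm (tsub X Y))
  (* Assumption A3 *)
  (F_coercive : forall M : R, exists K : R, forall X,
      K < tnorm X -> M < objF lam rho f X)
  (F_bdd_below : exists m : R, forall X, m <= objF lam rho f X)
  (* the TNNR iteration and Assumption A4 *)
  (X : nat -> tensor R n1 n2 n3) (theta1 theta2 mu : nat -> R) (eps : R)
  (hX : TNNR_sequence lam rho rho' gradf X theta1 theta2 mu)
  (heps : 0 < eps < 1)
  (htheta1 : forall t, 0 <= theta1 t < (1 - eps) / 2)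
  (htheta2 : forall t, 0 <= theta2 t <= 1 / 2)
  (hmu_noninc : forall t, mu t.+1 <= mu t)
  (hmu0 : forall t, mu t <= mu 0%N)
  (hmu1 : forall t, theta2 t * Lf <= mu t * theta1 t)
  (hmu2 : forall t,
      (1 - theta2 t) * Lf / (1 - theta1 t - theta1 t.+1 - eps) <= mu t) :
  (* (i) bounded, with an accumulation point *)
  ((exists B : R, forall t, tnorm (X t) <= B) /\
   (exists (Xs : tensor R n1 n2 n3) (phi : nat -> nat),
     {homo phi : m n / (m < n)%N} /\ tcvg (fun l => X (phi l)) Xs)) /\
  (* (ii) F(X^t) converges *)
  cvgn (fun t => objF lam rho f (X t)) /\
  (* (iii) every accumulation point is stationary, and F(X^{t_l+1}) -> F(X_star) *)
  (forall (Xs : tensor R n1 n2 n3) (phi : nat -> nat),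
     {homo phi : m n / (m < n)%N} -> tcvg (fun l => X (phi l)) Xs ->
     limiting_subdiff (objF lam rho f) Xs (@tzero R n1 n2 n3) /\
     objF lam rho f (X (phi l).+1) @[l --> \oo] --> objF lam rho f Xs).
Proof.
have penalty_surrogate := surrogateZ (ltW hlam) (@spectral_penalty_surrogate
  R n1 n2 n3 rho rho' Lg rho_nonneg rho_deriv rho_concave rho'_lip
  (fun t t_ge0 => ltW (rho'_pos t t_ge0))).
have f_smooth := LipschitzGradient f_grad gradf_lip.
have steps : admissible_steps Lf eps theta1 theta2 mu.
  by split=> //; case/andP: heps.
split; last split.
- have [B X_le] := iterates_bounded penalty_surrogate f_smooth steps hX F_coercive.
  by split; [exists B|exact: tensor_bolzano_weierstrass X_le].
- exact: (objective_iterates_cvg penalty_surrogate f_smooth steps hX F_bdd_below).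
- move=> Xs phi phi_inc phi_cvg; split.
    exact: (accumulation_stationary penalty_surrogate f_smooth steps hX F_bdd_below
      phi_inc phi_cvg).
  exact: (next_objective_cvg penalty_surrogate f_smooth steps hX F_bdd_below
    phi_inc phi_cvg).
Qed.
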